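(* Let $T$ be a tree. Then either $T$ is a path or ${\rm I}_e(T)\le\frac{1}{3}|E(T)|$.
   Context: All graphs are finite and simple. A graph is locally irregular if no two adjacent vertices have the same degree. An edge-irregulator of a graph $G$ is a set $S\subseteq E(G)$ such that $G-S$ is locally irregular; ${\rm I}_e(G)$ is the minimum cardinality of an edge-irregulator of $G$. *)

(* Defs.v *)
From mathcomp Require Import all_boot.
Set Implicit Arguments. Unset Strict Implicit. Unset Printing Implicit Defensive.

Section Graphs.
Variable V : finType.

Definition simple_graph (e : rel V) : Prop := symmetric e /\ irreflexive e.

Definition edges (e : rel V) : {set {set V}} :=
  [set [set x; y] | x in V, y in V & e x y].

Definition deg (e : rel V) (x : V) : nat := #|[set y | e x y]|.

Definition del_edges (e : rel V) (S : {set {set V}}) : rel V :=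
  fun x y => e x y && ([set x; y] \notin S).

Definition locally_irregular (e : rel V) : bool :=
  [forall x, forall y, e x y ==> (deg e x != deg e y)].

Definition edge_irregulator (e : rel V) (S : {set {set V}}) : bool :=
  (S \subset edges e) && locally_irregular (del_edges e S).

(* I_e(G): minimum cardinality of an edge-irregulator
   (E(G) itself is always one, so the default value #|E(G)| is harmless) *)
Definition Ie (e : rel V) : nat :=
  \big[minn/#|edges e|]_(S in powerset (edges e) |
      edge_irregulator e S) #|S|.

Definition connected (e : rel V) : Prop := forall x y, connect e x y.

Definition acyclic (e : rel V) : Prop :=
  forall c : seq V, 3 <= size c -> uniq c -> ~ cycle e c.

Definition is_tree (e : rel V) : Prop :=
  simple_graph e /\ connected e /\ acyclic e.

Definition is_path_graph (e : rel V) : Prop :=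
  exists s : seq V, [/\ uniq s, (forall x, x \in s) &
    forall x y, e x y <->
      exists2 i, i.+1 < size s &
        (nth x s i = x /\ nth x s i.+1 = y) \/ (nth x s i = y /\ nth x s i.+1 = x)].

End Graphs.

(* Main.v *)
Require Import Defs.
From mathcomp Require Import all_boot.
From mathcomp Require Import all_algebra zify.
Set Implicit Arguments. Unset Strict Implicit. Unset Printing Implicit Defensive.

(* Root the tree at a vertex [r] of degree at least 3 (if there is none, a
   longest path exhausts the tree). For an edge [vw], the shrub of [w] below [v]
   consists of [vw] and of the branch of [w] away from [v]. A solution of a shrub
   removes a set [S] of its edges so that the branch of [w] becomes locally
   irregular; it is summarised by a pair [(s, g)], where [s] is [None] if [vw] is
   removed and [Some d] if [vw] is kept and [w] retains degree [d], and where
   [3 |S| <= (number of edges of the shrub) + g]. The eight lists of pairs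
   [types] are stable: if the shrub of every child of [w] has all the solutions
   of one of the lists, then so has the shrub of [w]. At the root, three or more
   shrubs with such solutions can be combined with total [g] at most 0.
   Stability is a finite check: a child with a cut of nonpositive [g] can be
   discarded, and five or more children of the other types can all be kept, since
   the degree exceeds every degree occurring in [types]. *)

(** * Arithmetic of profiles and the finite check of stability *)

Section Profiles.
Import GRing.Theory Num.Theory.
Local Open Scope ring_scope.

Local Notation state := (option nat * int)%type.
Local Notation profile := (seq state).

(* Each child gets one of its options; [k] children are kept, none of them with
   the degree [t] of their parent, and the values add up to at most [G]. *)
Fixpoint sel (t : nat) (cs : seq profile) (k : nat) (G : int) : bool :=
  if cs is c :: cs' then
    has (fun o : state =>
      if o.1 is Some d then [&& d != t, (0 < k)%N & sel t cs' k.-1 (G - o.2)]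
      else sel t cs' k (G - o.2)) c
  else (k == 0%N) && (0 <= G).

(* These values were found by computer search, starting from the shrub with a
   single edge (the first profile) and keeping only what stability needs. *)
Definition rigid : seq profile :=
  [:: [:: (None, 2); (Some 1%N, -1)];
      [:: (None, 4); (Some 1%N, 1); (Some 2, -2)];
      [:: (None, 2); (Some 2, 2); (Some 3, -4)];
      [:: (None, 4); (Some 3, -5)];
      [:: (None, 4); (Some 4, -8)]].

Definition severable : seq profile :=
  [:: [:: (None, -2)];
      [:: (None, 0); (Some 2, 0)];
      [:: (None, 0); (Some 4, 0)]].

Definition types := rigid ++ severable.

(** Without its parent edge, a vertex has as many neighbours as kept children, so [k] is both the
    count and the forbidden degree. *)
Definition balanced (cs : seq profile) (G : int) : bool :=
  has (fun k => sel k cs k G) (iota 0 (size cs).+1).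

Arguments balanced : simpl never.

(* With its parent edge, the shrub has one edge more than those of the children
   together: [g] changes by [-1] if it is kept and by [3 - 1] if it is removed. *)
Definition feasible (cs : seq profile) (o : state) : bool :=
  if o.1 is Some d then (0 < d)%N && sel d cs d.-1 (o.2 + 1)
  else balanced cs (o.2 - 2).

Fixpoint words (ts : seq profile) (n : nat) : seq (seq profile) :=
  if n is n'.+1 then [seq t :: s | t <- ts, s <- words ts n'] else [:: [::]].

Lemma mem_words ts s : {subset s <= ts} -> s \in words ts (size s).
Proof.
elim: s => // c s IH sub; apply: allpairs_f; first by apply: sub; rewrite mem_head.
by apply: IH => x xs; apply: sub; rewrite in_cons xs orbT.
Qed.

(** The empty word is the case of a leaf; words of length 5 or more are left to [sel_all]. *)
Lemma rigid_words_feasible :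
  all (fun n => all (fun cs => has (all (feasible cs)) types) (words rigid n))
    (iota 0 5).
Proof. by vm_compute. Qed.

(** Discarding severable children has to stop at three, so length 3 involves all of [types]; at
    length 4 only rigid words remain. *)
Lemma words_balanced :
  all (balanced^~ 0) (words types 3) && all (balanced^~ 0) (words rigid 4).
Proof. by vm_compute. Qed.

Lemma sel_le t cs k G G' : G <= G' -> sel t cs k G -> sel t cs k G'.
Proof.
elim: cs k G G' => [|c cs IH] k G G' le /=.
  by move=> /andP[-> G0] /=; lia.
move=> /hasP[o oc H]; apply/hasP; exists o => //; move: H.
have le' : G - o.2 <= G' - o.2 by lia.
by case: o.1 => [d /and3P[-> -> /=]|]; apply: IH.
Qed.

(** Cutting the inserted child has value at most 0 and does not change the number of kept
    children. *)
Lemma sel_insert t c a b k G :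
  c \in severable -> sel t (a ++ b) k G -> sel t (a ++ c :: b) k G.
Proof.
move=> cs; elim: a k G => [|x a IH] k G /=.
  have [g [gc g0]] : exists g, (None, g) \in c /\ g <= 0.
    by move: cs; rewrite !inE => /or3P[] /eqP->; [exists (-2) | exists 0 | exists 0].
  by move=> H; apply/hasP; exists (None, g) => //=; apply: sel_le H; lia.
move=> /hasP[o ox H]; apply/hasP; exists o => //; move: H.
by case: o.1 => [d /and3P[-> -> /=]|]; apply: IH.
Qed.

(** Every rigid profile has a kept option of degree at most 4, hence different from [t], and of
    value at most -1. *)
Lemma sel_all t cs : {subset cs <= rigid} -> (4 < t)%N ->
  sel t cs (size cs) (- (size cs)%:Z).
Proof.
move=> sub t5; elim: cs sub => // c cs IH sub.
have [d [g [gc d5 g1]]] : exists d g, [/\ (Some d, g) \in c, (d < 5)%N & g <= -1].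
  have : c \in rigid by apply: sub; rewrite mem_head.
  rewrite !inE => /or4P[|||/orP[]] /eqP->.
  - by exists 1%N, (-1).
  - by exists 2, (-2).
  - by exists 3, (-4).
  - by exists 3, (-5).
  - by exists 4, (-8).
rewrite [size _]/= [sel _ _ _ _]/=; apply/hasP; exists (Some d, g) => //=.
apply/andP; split; first by rewrite neq_ltn; apply/orP; left; lia.
apply: (sel_le (G := - (size cs)%:Z)); first by rewrite /=; lia.
apply: IH => x xs; apply: sub; by rewrite in_cons xs orbT.
Qed.

Lemma balancedP cs G :
  reflect (exists2 k, (k <= size cs)%N & sel k cs k G) (balanced cs G).
Proof.
apply: (iffP hasP) => -[k]; rewrite ?mem_iota => k_le H; exists k => //.
by rewrite mem_iota.
Qed.

Lemma balanced_insert c a b G :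
  c \in severable -> balanced (a ++ b) G -> balanced (a ++ c :: b) G.
Proof.
move=> cs /balancedP[k k_le H]; apply/balancedP; exists k.
  by move: k_le; rewrite !size_cat /=; lia.
exact: sel_insert.
Qed.

Lemma feasible_insert c a b o :
  c \in severable -> feasible (a ++ b) o -> feasible (a ++ c :: b) o.
Proof.
move=> cs; case: o => [[d|] g]; rewrite /feasible /=.
  by move=> /andP[-> /=]; apply: sel_insert.
exact: balanced_insert.
Qed.

Lemma rigid_or_severable cs : {subset cs <= types} ->
  {subset cs <= rigid} \/
  exists c a b, [/\ c \in severable, cs = a ++ c :: b & {subset a ++ b <= types}].
Proof.
move=> sub; have [/hasP[c ccs csev]|] := boolP (has [in severable] cs).
  right; case/splitPr: ccs sub => a b sub; exists c, a, b; split=> // x xab.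
  by apply: sub; move: xab; rewrite !mem_cat in_cons => /orP[] ->; rewrite ?orbT.
rewrite -all_predC => /allP nsev; left=> x xcs.
have := sub x xcs; rewrite mem_cat => /orP[] // xs.
by have := nsev x xcs; rewrite /= xs.
Qed.

Lemma types_closed cs : {subset cs <= types} ->
  exists2 q, q \in types & all (feasible cs) q.
Proof.
have [n] := ubnP (size cs); elim: n cs => // n IH cs lt_n sub.
have [rig|[c [a [b [csev def_cs sub']]]]] := rigid_or_severable sub; last first.
  have [|q qt /allP H] := IH (a ++ b) _ sub'.
    by move: lt_n; rewrite def_cs !size_cat /=; lia.
  by exists q => //; apply/allP => o oq; rewrite def_cs; apply/feasible_insert/H.
have [le5|gt5] := ltnP (size cs) 5.
  have /allP/(_ (size cs)) := rigid_words_feasible.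
  by rewrite mem_iota => /(_ le5) /allP/(_ _ (mem_words rig)) /hasP.
(* Keeping all [n >= 5] children has value at most [-n], while a cut with [g = -2] allows a total of
   -4. *)
exists [:: (None, -2)]; first by [].
rewrite /= andbT /feasible /=; apply/balancedP; exists (size cs) => //.
by apply: sel_le (sel_all rig gt5); lia.
Qed.

Lemma types_balanced cs : {subset cs <= types} -> (2 < size cs)%N -> balanced cs 0.
Proof.
have /andP[/allP bal3 /allP bal4] := words_balanced.
have [n] := ubnP (size cs); elim: n cs => // n IH cs lt_n sub ge3.
have [eq3|ne3] := eqVneq (size cs) 3.
  by apply: bal3; have := mem_words sub; rewrite eq3.
have [rig|[c [a [b [csev def_cs sub']]]]] := rigid_or_severable sub; last first.
  rewrite def_cs; apply: balanced_insert => //.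
  have sz : size cs = (size (a ++ b)).+1 by rewrite def_cs !size_cat /=; lia.
  by apply: IH => //; move: sz lt_n ge3 ne3; move: (size _) (size _) => p q; lia.
have [eq4|ne4] := eqVneq (size cs) 4.
  by apply: bal4; have := mem_words rig; rewrite eq4.
apply/balancedP; exists (size cs) => //.
by apply: sel_le (sel_all rig _); lia.
Qed.

End Profiles.

Lemma bigminn_le (I : eqType) (r : seq I) (P : pred I) (F : I -> nat) d i :
  i \in r -> P i -> \big[minn/d]_(j <- r | P j) F j <= F i.
Proof.
elim: r => // j r IH; rewrite in_cons big_cons => /orP[/eqP<-|ir] Pi.
  by rewrite Pi geq_minl.
case: ifP => _; last exact: IH.
exact: leq_trans (geq_minr _ _) (IH ir Pi).
Qed.

(** * Branches and shrubs of an acyclic graph *)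

Section Acyclic.
Variables (V : finType) (e : rel V).
Hypotheses (e_sym : symmetric e) (e_irr : irreflexive e) (e_acyc : acyclic e).

Definition avoid (v : V) : rel V := fun x y => [&& e x y, x != v & y != v].

Definition branch (v w : V) : {set V} := [set x | connect (avoid v) w x].

Lemma avoid_sym v : symmetric (avoid v).
Proof. by move=> x y; rewrite /avoid e_sym [(x != v) && _]andbC. Qed.

Lemma edge_neq x y : e x y -> x != y.
Proof. by apply: contraTneq => ->; rewrite e_irr. Qed.

Lemma avoid_path v x p : path (avoid v) x p -> path e x p /\ v \notin p.
Proof.
elim: p x => // y p IH x /= /andP[/and3P[exy _ yv] /IH[-> vp]].
by rewrite exy in_cons negb_or eq_sym yv vp.
Qed.

Lemma path_avoid v x p :
  path e x p -> v \notin x :: p -> path (avoid v) x p.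
Proof.
elim: p x => // y p IH x /= /andP[exy pth].
rewrite !in_cons !negb_or => /and3P[xv yv vp].
rewrite /avoid exy eq_sym xv eq_sym yv /= IH //.
by rewrite in_cons negb_or yv.
Qed.

Lemma branch_root v w : w \in branch v w.
Proof. by rewrite inE connect0. Qed.

Lemma branch_avoid v w x : e v w -> x \in branch v w -> x != v.
Proof.
move=> evw; rewrite inE => /connectP[p /avoid_path[_ vp] ->].
have := mem_last w p; rewrite in_cons => /orP[/eqP->|].
  by rewrite eq_sym edge_neq.
by apply: contraTneq => ->.
Qed.

Lemma branch_step v w x y :
  e v w -> x \in branch v w -> e x y -> y != v -> y \in branch v w.
Proof.
move=> evw xB exy yv; have xv := branch_avoid evw xB.
move: xB; rewrite !inE => wx; apply: connect_trans wx (connect1 _).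
by rewrite /avoid exy xv.
Qed.

(* A second neighbour of [v] in the branch would close a cycle through [v]. *)
Lemma branch_neighbour v w x : e v w -> x \in branch v w -> e v x -> x = w.
Proof.
move=> evw; rewrite inE => /connectP[p pth ->] evx; apply/eqP.
move: pth evx; case/shortenP => q pth uq _ {p} evx.
have [epth vq] := avoid_path pth.
case: q => // y q in pth uq evx epth vq *.
have cyc : cycle e [:: v, w, y & q]
  by move: epth evx; rewrite /= evw rcons_path => /andP[-> ->]; rewrite e_sym.
case: (@e_acyc [:: v, w, y & q]) => //=.
by rewrite /= in_cons negb_or edge_neq // vq; move: uq; rewrite /= => ->.
Qed.

(** If the branches meet, then [w] lies in the branch of [w'], where [w'] is the only neighbour of
    [v]. *)
Lemma branch_disjoint v w w' x :
  e v w -> e v w' -> x \in branch v w -> x \in branch v w' -> w = w'.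
Proof.
move=> evw evw' xB xB'; apply: branch_neighbour evw' _ evw.
move: xB xB'; rewrite !inE => wx w'x; apply: connect_trans w'x _.
by rewrite (sym_connect_sym (@avoid_sym v)).
Qed.

(** The vertex [v] is not in [branch w u], where [u] is the only neighbour of [w]. So a walk from
    [u] avoiding [w] also avoids [v]. *)
Lemma branch_sub v w u : e v w -> e w u -> u != v -> branch w u \subset branch v w.
Proof.
move=> evw ewu uv; apply/subsetP => x; rewrite inE => /connectP[p pth ->] {x}.
have uB : u \in branch v w by apply: branch_step ewu uv; rewrite ?branch_root.
have vB : v \notin branch w u.
  by apply: contraNN uv => vB; rewrite (branch_neighbour ewu vB) // e_sym.
suff H x : x \in branch w u -> x \in branch v w -> path (avoid w) x p ->
    last x p \in branch v w by apply: (H u); rewrite ?branch_root.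
elim: p {pth} x => //= y p IH x xu xv /andP[/and3P[exy xw yw] pth].
have yu := branch_step ewu xu exy yw.
apply: IH => //; apply: branch_step xv exy _ => //.
by apply: contraNneq vB => <-.
Qed.

(** Take for [u] the second vertex of a simple path from [w] to [x], which never returns to [w]. *)
Lemma branch_split v w x : e v w -> x \in branch v w -> x != w ->
  exists u, [/\ e w u, u != v & x \in branch w u].
Proof.
move=> evw; rewrite inE => /connectP[p pth ->] {x}.
case: (shortenP pth) => q; case: q => [|u q]; first by rewrite /= eqxx.
move=> /= /andP[/and3P[ewu _ uv] qpth] /andP[wq uq] _ _.
exists u; split=> //; rewrite inE; apply/connectP; exists q => //.
by apply: path_avoid => //; have [] := avoid_path qpth.
Qed.

Lemma branch_card v w u :
  e v w -> e w u -> u != v -> #|branch w u| < #|branch v w|.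
Proof.
move=> evw ewu uv; apply: proper_card; apply/properP; split.
  exact: branch_sub.
exists w; first exact: branch_root.
by apply/negP => /(branch_avoid ewu); rewrite eqxx.
Qed.

(** One end in the branch suffices, so [vw] is included; for an edge [vw], no other edge leaves the
    branch. *)
Definition shrub (v w : V) : {set {set V}} :=
  [set [set x; y] | x in branch v w, y in V & e x y].

Lemma shrub_edge v w x y : x \in branch v w -> e x y -> [set x; y] \in shrub v w.
Proof. by move=> xB exy; apply/imset2P; exists x y => //; rewrite inE exy. Qed.

Lemma shrub_base v w : e v w -> [set v; w] \in shrub v w.
Proof. by move=> evw; rewrite setUC shrub_edge ?branch_root // e_sym. Qed.

Lemma shrub_touches v w E : E \in shrub v w -> exists2 x, x \in E & x \in branch v w.
Proof. by case/imset2P => x y xB _ ->; exists x; rewrite ?set21. Qed.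

Lemma shrub_sub v w : shrub v w \subset edges e.
Proof.
apply/subsetP => E /imset2P[x y xB]; rewrite inE => /andP[_ exy] ->.
by apply/imset2P; exists x y; rewrite // inE.
Qed.

Lemma shrub_mono v w u : e v w -> e w u -> u != v -> shrub w u \subset shrub v w.
Proof.
move=> evw ewu uv; apply/subsetP => E /imset2P[x y xB]; rewrite inE => /andP[_ exy] ->.
by apply: shrub_edge => //; apply: subsetP xB; apply: branch_sub.
Qed.

(** Some end of the edge [xy] lies in [branch v u]. It differs from [v], so it also lies in
    [branch v w]. *)
Lemma shrub_at v w u x y : e v w -> e v u -> x \in branch v w -> e x y ->
  [set x; y] \in shrub v u -> u = w.
Proof.
move=> evw evu xB exy /shrub_touches[z zxy zB].
case/set2P: zxy zB => -> zB.
  exact: branch_disjoint evu evw zB xB.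
apply: (branch_disjoint evu evw zB); apply: (branch_step evw xB exy).
exact: branch_avoid evu zB.
Qed.

Lemma shrub_disjoint v w u E :
  e v w -> e v u -> E \in shrub v w -> E \in shrub v u -> u = w.
Proof.
move=> evw evu /imset2P[x y xB]; rewrite inE => /andP[_ exy] ->.
exact: shrub_at.
Qed.

Lemma card_shrub_union w (F : V -> {set {set V}}) :
  (forall u, e w u -> F u \subset shrub w u) ->
  #|\bigcup_(u | e w u) F u| = \sum_(u | e w u) #|F u|.
Proof.
(* Other vertices contribute the empty set, which makes the family disjoint over all of [V]. *)
move=> sub; rewrite big_mkcond /= -sum1_card partition_disjoint_bigcup /=.
  rewrite [RHS]big_mkcond; apply: eq_bigr => u _.
  by case: ifP => _; rewrite sum1_card ?cards0.
move=> u u' neq; rewrite -setI_eq0; apply/eqP/setP => E; rewrite !inE.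
apply: contraNF neq => /andP[]; case: ifP => [ewu EF|]; last by rewrite inE.
case: ifP => [ewu' EF'|]; last by rewrite inE.
by apply/eqP/(@shrub_disjoint w _ _ E) => //; [apply: subsetP EF' | apply: subsetP EF];
  apply: sub.
Qed.

(** Only edges inside [A] are tested, but degrees are those of the whole graph minus [T]: the degree
    of [w] in [branch v w] counts the edge to [v] if it is kept. *)
Definition irregular_on (A : {set V}) (T : {set {set V}}) : Prop :=
  forall x y, x \in A -> y \in A -> del_edges e T x y ->
    deg (del_edges e T) x != deg (del_edges e T) y.

(** * Gluing sets of edges chosen in the shrubs around a vertex *)

Section Gluing.
Variables (w : V) (S : V -> {set {set V}}).
Hypothesis S_shrub : forall u, e w u -> S u \subset shrub w u.

Let U := \bigcup_(u | e w u) S u.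

Lemma glue_mem u x y : e w u -> x \in branch w u -> e x y ->
  ([set x; y] \in U) = ([set x; y] \in S u).
Proof.
move=> ewu xB exy; apply/bigcupP/idP => [[u' ewu' Su']|Su]; last by exists u.
by rewrite -(@shrub_at w u u' x y) //; apply: subsetP Su'; apply: S_shrub.
Qed.

Lemma glue_del u x y : e w u -> x \in branch w u ->
  del_edges e U x y = del_edges e (S u) x y.
Proof.
move=> ewu xB; rewrite /del_edges; case exy: (e x y) => //=.
by rewrite (glue_mem ewu).
Qed.

Lemma glue_deg u x : e w u -> x \in branch w u ->
  deg (del_edges e U) x = deg (del_edges e (S u)) x.
Proof.
move=> ewu xB; apply: eq_card => y; rewrite !inE; exact: glue_del.
Qed.

Lemma glue_deg_center :
  deg (del_edges e U) w = \sum_(u | e w u) ([set w; u] \notin S u).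
Proof.
rewrite /deg -sum1_card [RHS]big_mkcond [LHS]big_mkcond; apply: eq_bigr => u _.
rewrite inE /del_edges; case ewu: (e w u) => //=.
by rewrite setUC (glue_mem ewu) ?branch_root // 1?e_sym //; case: ifP.
Qed.

(** The predicate [P] selects all neighbours at the root and all but the parent elsewhere. Degrees
    inside a branch are unaffected by gluing, and an edge from [w] into a branch ends at its root,
    where the last hypothesis applies. *)
Lemma glue_irregular (A : {set V}) (P : pred V) :
  (forall u, P u -> e w u) ->
  (forall x, x \in A -> x = w \/ exists2 u, P u & x \in branch w u) ->
  (forall u, P u -> irregular_on (branch w u) (S u)) ->
  (forall u, P u -> [set w; u] \notin S u ->
     deg (del_edges e (S u)) u != deg (del_edges e U) w) ->
  irregular_on A U.
Proof.
move=> Pe cover irr cen.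
have center u y : P u -> y \in branch w u -> del_edges e U w y ->
    deg (del_edges e U) y != deg (del_edges e U) w.
  move=> Pu yB /andP[ewy nU]; have ewu := Pe u Pu.
  have yu : y = u by apply: branch_neighbour ewu yB ewy.
  rewrite {y}yu in yB ewy nU *; rewrite (glue_deg ewu) //; apply: cen => //.
  by move: nU; rewrite setUC (glue_mem ewu) // e_sym.
have del_sym x y : del_edges e U x y = del_edges e U y x.
  by rewrite /del_edges e_sym setUC.
move=> x y xA yA dxy; have [xw|[u Pu xB]] := cover x xA.
  have [yw|[u Pu yB]] := cover y yA.
    by move: dxy; rewrite xw yw /del_edges e_irr.
  by rewrite xw eq_sym; apply: center Pu yB _; rewrite -xw.
have [yw|yw] := eqVneq y w.
  by rewrite yw; apply: center Pu xB _; rewrite -yw del_sym.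
have ewu := Pe u Pu; have yB : y \in branch w u.
  by apply: branch_step ewu xB _ yw; case/andP: dxy.
by rewrite !(glue_deg ewu) //; apply: (irr u) => //; rewrite -(glue_del _ ewu).
Qed.

End Gluing.

(** * Realizing profiles by sets of removed edges *)

Definition realizable (v w : V) (o : option nat * int) : Prop :=
  exists S : {set {set V}},
    [/\ S \subset shrub v w,
        irregular_on (branch v w) S,
        if o.1 is Some d then [set v; w] \notin S /\ deg (del_edges e S) w = d
        else [set v; w] \in S
      & ((3 * #|S|)%:Z <= #|shrub v w|%:Z + o.2)%R].

(** Counterpart of [sel] in the graph, over a list of neighbours to match its recursion. *)
Definition selection (w : V) (t : nat) (us : seq V) (k : nat) (G : int)
    (S : V -> {set {set V}}) : Prop :=
  [/\ {in us, forall u, [/\ S u \subset shrub w u,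
         irregular_on (branch w u) (S u)
       & [set w; u] \notin S u -> deg (del_edges e (S u)) u != t]},
      count (fun u => [set w; u] \notin S u) us = k
    & ((3 * \sum_(u <- us) #|S u|)%:Z <= (\sum_(u <- us) #|shrub w u|)%:Z + G)%R].

Lemma sel_selection w t us q k G :
  uniq us -> {in us, forall u o, o \in q u -> realizable w u o} ->
  sel t [seq q u | u <- us] k G -> exists S, selection w t us k G S.
Proof.
elim: us k G => [|u us IH] k G /=.
  by move=> _ _ /andP[/eqP-> G0]; exists (fun=> set0); split; rewrite // !big_nil; lia.
move=> /andP[u_us uniq_us] real /hasP[[s g] oq /= H].
have [S0 [S0sub S0irr S0st S0card]] := real u (mem_head _ _) _ oq; rewrite /= in S0st S0card.
have real' : {in us, forall u o, o \in q u -> realizable w u o}.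
  by move=> x xus; apply: real; rewrite in_cons xus orbT.
(* Here [k'] is the number of children of [us] still to be kept, whether [u] is kept or cut. *)
have [k' [k'E uk selk]] : exists k', [/\ k = ([set w; u] \notin S0) + k',
     [set w; u] \notin S0 -> deg (del_edges e S0) u != t
   & sel t [seq q u | u <- us] k' (G - g)%R].
  case: s {oq} H S0st => [d /and3P[dt k0 selk] [nS dE]|selk inS].
    by exists k.-1; rewrite nS dE; split=> //; lia.
  by exists k; rewrite inS.
have [S [Sus Sk Scard]] := IH _ _ uniq_us real' selk.
exists (fun x => if x == u then S0 else S x).
have neq x : x \in us -> (x == u) = false by move=> xus; apply: contraNF u_us => /eqP <-.
split; rewrite /= ?big_cons.
- move=> x; rewrite in_cons; case: eqVneq => [-> _|_ /= xus] //.
  exact: Sus.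
- rewrite eqxx k'E -Sk; congr (_ + _)%N; apply: eq_in_count => x xus.
  by rewrite neq.
- have -> : \sum_(x <- us) #|if x == u then S0 else S x| = \sum_(x <- us) #|S x|.
    by apply: eq_big_seq => x xus; rewrite neq.
  have arith (h : int) (a b c d : nat) : ((3 * a)%:Z <= c%:Z + h ->
      (3 * b)%:Z <= d%:Z + (G - h) -> (3 * (a + b))%:Z <= (c + d)%N%:Z + G)%R by lia.
  by rewrite eqxx; apply: arith S0card Scard.
Qed.

Lemma sum_selection w t (P : pred V) k G S :
  selection w t (enum P) k G S ->
  [/\ forall u, P u -> [/\ S u \subset shrub w u,
         irregular_on (branch w u) (S u)
       & [set w; u] \notin S u -> deg (del_edges e (S u)) u != t],
      \sum_(u | P u) ([set w; u] \notin S u) = k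
    & ((3 * \sum_(u | P u) #|S u|)%:Z
         <= (\sum_(u | P u) #|shrub w u|)%:Z + G)%R].
Proof.
case=> H1 H2 H3; split.
- by move=> u Pu; apply: H1; rewrite mem_enum.
- by rewrite -H2 -sum1_count [RHS]big_mkcond big_enum /=; apply: eq_bigr => u _; case: ifP.
- by move: H3; rewrite !big_enum.
Qed.

Lemma sum_update w v (f : V -> nat) a : e w v ->
  \sum_(u | e w u) (if u == v then a else f u) =
  a + \sum_(u | e w u && (u != v)) f u.
Proof.
move=> ewv; rewrite (bigD1 v) //= eqxx; congr (_ + _)%N.
by apply: eq_bigr => u /andP[_ /negbTE->].
Qed.

(** The parent [v] is treated as one more neighbour of [w], with removed set [{vw}] or empty, so
    that gluing runs over all neighbours. *)
Lemma realizable_node v w (cut : bool) t k G S : e v w ->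
  t = (~~ cut) + k ->
  selection w t (enum [pred u | e w u && (u != v)]) k G S ->
  realizable v w (if cut then (None, G + 2)%R else (Some k.+1, G - 1)%R).
Proof.
move=> evw tE /sum_selection[/= Sok Sk Scard].
have {}Sok u : e w u -> u != v -> _ := fun ewu uv => Sok u (introT andP (conj ewu uv)).
have ewv : e w v by rewrite e_sym.
pose S' u := if u == v then (if cut then [set [set v; w]] else set0) else S u.
have S'sub u : e w u -> S' u \subset shrub w u.
  rewrite /S'; case: eqVneq => [-> _|uv ewu]; last by have [] := Sok u ewu uv.
  by case: (cut); rewrite ?sub0set // sub1set setUC shrub_base.
pose U := \bigcup_(u | e w u) S' u.
have Udeg : deg (del_edges e U) w = t.
  rewrite glue_deg_center // tE -Sk -(sum_update _ (~~ cut : nat) ewv).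
  apply: eq_bigr => u _; rewrite /S'; case: eqVneq => [->|_] //.
  by rewrite setUC; case: (cut); rewrite inE ?eqxx.
have Ucard : #|U| = cut + \sum_(u | e w u && (u != v)) #|S u|.
  rewrite -(sum_update _ (cut : nat) ewv) card_shrub_union //.
  apply: eq_bigr => u _; rewrite /S'; case: eqVneq => // _.
  by case: (cut); rewrite ?cards1 ?cards0.
have shrub_card : 1 + \sum_(u | e w u && (u != v)) #|shrub w u| <= #|shrub v w|.
  (* Of the shrub in the direction of [v], only the edge [vw] is retained, since the rest need not
     belong to [shrub v w]. *)
  pose F u := if u == v then [set [set v; w]] else shrub w u.
  have Fsub u : e w u -> F u \subset shrub w u.
    by rewrite /F; case: eqVneq => // -> _; rewrite sub1set setUC shrub_base.
  rewrite -(sum_update _ 1 ewv) (eq_bigr (fun u => #|F u|)) => [|u _]; last first.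
    by rewrite /F; case: ifP; rewrite ?cards1.
  rewrite -card_shrub_union //; apply/subset_leq_card/bigcupsP => u ewu; rewrite /F.
  by case: eqVneq => [_|uv]; [rewrite sub1set shrub_base | apply: shrub_mono].
have vwU : ([set v; w] \in U) = cut.
  rewrite (glue_mem S'sub ewv) ?branch_root //.
  by rewrite /S' eqxx; case: (cut); rewrite inE ?eqxx.
exists U; split.
- apply/bigcupsP => u ewu; rewrite /S'; case: eqVneq => [_|uv].
    by case: (cut); rewrite ?sub0set // sub1set shrub_base.
  by apply: subset_trans (shrub_mono evw ewu uv); have [] := Sok u ewu uv.
- apply: (@glue_irregular w S' S'sub _ [pred u | e w u && (u != v)]).
  + by move=> u /andP[].
  + move=> x xB; have [->|xw] := eqVneq x w; first by left.
    have [u [ewu uv xu]] := branch_split evw xB xw.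
    by right; exists u; rewrite //= ewu.
  + by move=> u /andP[ewu uv]; rewrite /S' (negbTE uv); have [] := Sok u ewu uv.
  + by move=> u /andP[ewu uv]; rewrite -/U Udeg /S' (negbTE uv); have [] := Sok u ewu uv.
- case: (cut) vwU tE Udeg => vwU /= tE Udeg; first by rewrite vwU.
  by rewrite vwU Udeg tE.
- have arith (a b c d : nat) : a = cut + b -> ((3 * b)%:Z <= c%:Z + G)%R ->
      1 + c <= d -> ((3 * a)%:Z <= d%:Z + (if cut then G + 2 else G - 1))%R.
    by case: (cut); lia.
  by have := arith _ _ _ _ Ucard Scard shrub_card; case: (cut).
Qed.

Lemma profile_exists v w : e v w ->
  exists2 q, q \in types & forall o, o \in q -> realizable v w o.
Proof.
have [n] := ubnP #|branch v w|; elim: n v w => // n IH v w lt_n evw.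
(* Finite choice needs a profile for every vertex; those of non-children are arbitrary. *)
have /fin_all_exists[q qP] u : exists q, e w u && (u != v) ->
    q \in types /\ forall o, o \in q -> realizable w u o.
  have [/andP[ewu uv]|_] := boolP (e w u && (u != v)); last by exists [::].
  have [|//|q qt qr] := IH w u; last by exists q.
  by apply: leq_trans (branch_card evw ewu uv) _.
pose us := enum [pred u | e w u && (u != v)].
have usP u : u \in us -> e w u && (u != v) by rewrite mem_enum.
have [|p pt /allP pf] := @types_closed [seq q u | u <- us].
  by move=> _ /mapP[u /usP /qP[] qt _ ->].
have qreal : {in us, forall u o, o \in q u -> realizable w u o}.
  by move=> u /usP /qP[].
have us_uniq : uniq us by apply: enum_uniq.
exists p => // -[[d|] g] /pf; rewrite /feasible /=.
  move=> /andP[d0 /(sel_selection us_uniq qreal)[S]].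
  by move=> /(@realizable_node v w false d _ _ _ evw); rewrite prednK // GRing.addrK;
    apply; lia.
move=> /balancedP[k _ /(sel_selection us_uniq qreal)[S]].
by move=> /(@realizable_node v w true k _ _ _ evw); rewrite GRing.subrK; apply.
Qed.

End Acyclic.

(** * Trees with a vertex of degree at least 3 *)

Section Trees.
Variables (V : finType) (e : rel V).

Lemma Ie_le S : edge_irregulator e S -> Ie e <= #|S|.
Proof.
move=> irr; apply: bigminn_le; first by rewrite mem_index_enum.
by rewrite inE irr andbT; case/andP: irr.
Qed.

Hypothesis e_tree : is_tree e.

Let e_sym : symmetric e. Proof. by case: e_tree => -[]. Qed.
Let e_irr : irreflexive e. Proof. by case: e_tree => -[]. Qed.
Let e_conn : connected e. Proof. by case: e_tree => _ []. Qed.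
Let e_acyc : acyclic e. Proof. by case: e_tree => _ []. Qed.

Lemma tree_cover r x : x = r \/ exists2 u, e r u & x \in branch e r u.
Proof.
case/connectP: (e_conn r x) => p pth ->.
case: (shortenP pth) => -[|u q] /=; first by left.
move=> /andP[eru qpth] /andP[rq uq] _; right; exists u => //.
rewrite inE; apply/connectP; exists q => //.
exact: path_avoid.
Qed.

Lemma Ie_branching r : 2 < deg e r -> 3 * Ie e <= #|edges e|.
Proof.
move=> deg3.
have /fin_all_exists[q qP] u : exists q, e r u ->
    q \in types /\ forall o, o \in q -> realizable e r u o.
  have [eru|_] := boolP (e r u); last by exists [::].
  by have [q qt qr] := profile_exists e_sym e_irr e_acyc eru; exists q.
have usP u : u \in enum (e r) -> e r u by rewrite mem_enum.
have [||k _] := balancedP _ _ (@types_balanced [seq q u | u <- enum (e r)] _ _).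
- by move=> _ /mapP[u /usP /qP[] qt _ ->].
- rewrite size_map -cardE; move: deg3; rewrite /deg; congr (_ < _).
  by apply: eq_card => u; rewrite inE.
have qreal : {in enum (e r), forall u o, o \in q u -> realizable e r u o}.
  by move=> u /usP /qP[].
move=> /(sel_selection (enum_uniq _) qreal)[S] /sum_selection[Sok Sk Scard].
have Ssub u : e r u -> S u \subset shrub e r u by move=> /Sok[].
pose U := \bigcup_(u | e r u) S u.
(* In [balanced] the forbidden degree is this same [k], so no kept neighbour of [r] has the degree
   of [r]. *)
have Udeg : deg (del_edges e U) r = k by rewrite glue_deg_center.
have Uirr : edge_irregulator e U.
  apply/andP; split.
    by apply/bigcupsP => u eru; apply: subset_trans (Ssub u eru) (shrub_sub _ _ _).
  apply/forallP => x; apply/forallP => y; apply/implyP => dxy.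
  apply: (@glue_irregular _ _ e_sym e_irr e_acyc r S Ssub setT (e r)) => //.
  - by move=> z _; apply: tree_cover.
  - by move=> u /Sok[].
  - by move=> u /Sok[_ _]; rewrite -/U Udeg.
have Ecard : \sum_(u | e r u) #|shrub e r u| <= #|edges e|.
  rewrite -(card_shrub_union e_sym e_irr e_acyc) //.
  by apply/subset_leq_card/bigcupsP => u _; apply: shrub_sub.
rewrite GRing.addr0 -(card_shrub_union e_sym e_irr e_acyc Ssub) in Scard.
by apply: leq_trans (leq_trans Scard Ecard); rewrite leq_mul2l Ie_le.
Qed.

(** * Trees of maximum degree at most 2 *)

Lemma longest_path : exists s : seq V, [/\ uniq s, sorted e s &
  forall s', uniq s' -> sorted e s' -> size s' <= size s].
Proof.
pose P n := [exists t : n.-tuple V, uniq t && sorted e t].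
have P0 : exists n, P n by exists 0; apply/existsP; exists [tuple].
have Pmax n : P n -> n <= #|V|.
  by case/existsP => t /andP[ut _]; rewrite -(size_tuple t) -(card_uniqP ut) max_card.
case: (ex_maxnP P0 Pmax) => n /existsP[t /andP[ut st]] nmax.
exists t; split=> // s us ss; rewrite size_tuple; apply: nmax.
by apply/existsP; exists (in_tuple s); rewrite us ss.
Qed.

(** If [y] does not directly follow [x], the edge [xy] and the segment between them form a cycle on
    at least three vertices. *)
Lemma path_chordless p x q y x0 : uniq (p ++ x :: q) -> sorted e (p ++ x :: q) ->
  y \in q -> e x y ->
  exists2 i, i.+1 < size (p ++ x :: q) &
    nth x0 (p ++ x :: q) i = x /\ nth x0 (p ++ x :: q) i.+1 = y.
Proof.
move=> us ss yq exy; case/splitPr: yq us ss => -[|z q1] q2 us ss.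
  exists (size p); first by rewrite size_cat /=; lia.
  by rewrite !nth_cat ltnn subnn ltnNge leqnSn subSnn.
have sE : p ++ x :: (z :: q1) ++ y :: q2 = p ++ (x :: rcons (z :: q1) y) ++ q2.
  by rewrite /= cat_rcons.
case: (@e_acyc (x :: rcons (z :: q1) y)).
- by rewrite /= size_rcons.
- by move: us; rewrite sE !cat_uniq => /and5P[].
rewrite /cycle rcons_path last_rcons e_sym exy andbT.
by move: ss; rewrite sE => /cat_sorted2[_ /cat_sorted2[]].
Qed.

(** If a vertex is missed, connectivity gives an edge from some [b] on the path to some [y] off it.
    If [b] is an end, [y] prolongs the path; otherwise [b] has three neighbours. *)
Lemma longest_path_spans s : (forall x, deg e x <= 2) ->
  uniq s -> sorted e s ->
  (forall s', uniq s' -> sorted e s' -> size s' <= size s) ->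
  forall x, x \in s.
Proof.
move=> deg2 us ss smax x; apply/negPn/negP => xs.
have [a as_] : exists a, a \in s.
  case: s us ss smax xs => [|a s] us ss smax xs; last by exists a; rewrite mem_head.
  by have := smax [:: x] isT isT.
have [b [y [bs ys eby]]] : exists b y, [/\ b \in s, y \notin s & e b y].
  case/connectP: (e_conn a x) => p pth xE; rewrite {}xE in xs.
  elim: p a as_ pth xs => [|c p IH] a as_ /=; first by rewrite as_.
  move=> /andP[eac pth] xs; have [cs|cs] := boolP (c \in s); first exact: IH cs pth xs.
  by exists a, c.
case/splitPr: bs us ss smax xs ys {as_} => p q us ss smax _ ys.
case: p us ss smax ys => [|p0 p] us ss smax ys.
  suff: size (y :: b :: q) <= size (b :: q) by rewrite /= ltnn.
  by apply: smax; [move: ys us => /= -> | rewrite /= e_sym eby].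
case: q us ss smax ys => [|c q] us ss smax ys.
  suff: size (rcons (p0 :: p ++ [:: b]) y) <= size (p0 :: p ++ [:: b]).
    by rewrite size_rcons ltnn.
  apply: smax; first by rewrite rcons_uniq ys.
  by move: ss; rewrite /= rcons_path last_cat /= eby andbT.
have := deg2 b; rewrite leqNgt => /negP[].
have /subset_leq_card : [set last p0 p; c; y] \subset [set z | e b z].
  apply/subsetP => z; rewrite !inE => /orP[/orP[]|] /eqP-> //.
    by move: ss; rewrite /= cat_path e_sym => /and3P[_ ->].
  by move: ss; rewrite /= cat_path /= => /and4P[].
apply: leq_trans; rewrite setUC cardsU1 cards2 !inE.
have lp := mem_last p0 p.
have [yl yc] : y != last p0 p /\ y != c.
  by split; apply: contraNneq ys => ->; rewrite mem_cat ?lp // !in_cons eqxx !orbT.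
have -> : last p0 p != c.
  move: us; rewrite cat_uniq => /and3P[_ /hasPn/(_ c) cp _].
  by apply: contraTneq lp => ->; apply: cp; rewrite !in_cons eqxx orbT.
by rewrite negb_or yl yc.
Qed.

Lemma bounded_degree_path : (forall x, deg e x <= 2) -> is_path_graph e.
Proof.
move=> deg2; have [s [us ss smax]] := longest_path.
have s_all := longest_path_spans deg2 us ss smax.
exists s; split=> // x y; split; last first.
  have /(sortedP x) step := ss.
  by move=> [i i_lt [] [xE yE]]; have := step i i_lt; rewrite xE yE // e_sym.
move=> exy; have := s_all x; have := s_all y => ys xs.
case/splitPr: xs us ss ys {s_all smax} => p q us ss.
rewrite mem_cat in_cons => /or3P[yp|/eqP yx|yq].
- case/splitPr: yp us ss => p1 p2; rewrite -catA /= => us ss.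
  have [||i i_lt iE] := @path_chordless p1 y (p2 ++ x :: q) x x us ss.
  + by rewrite mem_cat mem_head orbT.
  + by rewrite e_sym.
  by exists i => //; right.
- by move: exy; rewrite yx e_irr.
- have [i i_lt iE] := @path_chordless p x q y x us ss yq exy.
  by exists i => //; left.
Qed.

End Trees.

Unset Implicit Arguments.

Theorem theorem8 (V : finType) (e : rel V) :
  is_tree e -> is_path_graph e \/ 3 * Ie e <= #|edges e|.
Proof.
move=> e_tree; have [/existsP[r deg3]|/existsPn deg2] := boolP [exists r, 2 < deg e r].
  by right; apply: Ie_branching deg3.
by left; apply: bounded_degree_path => // x; rewrite leqNgt.
Qed.
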